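(* Let $X$ be a finite-dimensional real Hilbert space, let $A$ and $B$ be nonempty closed convex subsets of $X$ with projectors $P_A$ and $P_B$, and let $T=P_BP_A$. Suppose that $\operatorname{Fix}T=\varnothing$. Let $b_0:=x\in X$ and set, for every $n\in\mathbb{N}=\{0,1,2,\dots\}$, $a_{n+1}:=P_Ab_n$ and $b_{n+1}:=P_Ba_{n+1}=Tb_n$. Then the following hold: (i) $\|a_n\|\to+\infty$, $\|b_n\|\to+\infty$, $b_n-a_n\to g$, and $a_{n+1}-b_n\to-g$, where $g:=P_{\overline{B-A}}(0)$. (ii) All cluster points of $(b_n/\|b_n\|)_{n\in\mathbb{N}}$ lie in the set $$\big((\operatorname{rec}A)\cap(\operatorname{rec}B)\big)\cap\big((\operatorname{rec}A)\cap(\operatorname{rec}B)\big)^{\oplus},$$ which is a closed convex cone in $X$ that properly contains $\{0\}$. (iii) Neither $(\operatorname{rec}A)\cap(\operatorname{rec}B)$ nor $((\operatorname{rec}A)\cap(\operatorname{rec}B))^{\oplus}$ is a linear subspace of $X$. (iv) The sequence $(Q_n(x))_{n\in\mathbb{N}}=(b_n/\|b_n\|)_{n\in\mathbb{N}}$ converges provided one of the following holds: (a) $((\operatorname{rec}A)\cap(\operatorname{rec}B))\cap((\operatorname{rec}A)\cap(\operatorname{rec}B))^{\oplus}$ is a ray; (b) $(\operatorname{rec}A)\cap(\operatorname{rec}B)$ is a ray; (c) $\dim X=2$.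
   Context: For a nonempty closed convex set $C\subseteq X$, $P_C$ is the nearest point mapping onto $C$. $\operatorname{Fix}T=\{x\in X: Tx=x\}$. For a nonempty convex set $S\subseteq X$, the recession cone is $\operatorname{rec}S:=\{x\in X : x+S\subseteq S\}$. For $S\subseteq X$, $S^{\ominus}:=\{x\in X : \sup_{s\in S}\langle x,s\rangle\le 0\}$ and $S^{\oplus}:=-S^{\ominus}$. $B-A=\{b-a : b\in B,\ a\in A\}$, and the overline denotes closure. A ray is a set of the form $\{td : t\ge 0\}$ with $d\in X\setminus\{0\}$. $Q_n(x):=T^nx/\|T^nx\|$; the quotient sequences are considered for all $n$ large enough that they are defined. *)

(* Defs.v *)
From HB Require Import structures.
From mathcomp Require Import all_boot all_order all_algebra.
From mathcomp Require Import sesquilinear.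
From mathcomp Require Import all_classical all_reals all_analysis.

Set Implicit Arguments.
Unset Strict Implicit.
Unset Printing Implicit Defensive.

Import Order.TTheory GRing.Theory Num.Theory.
Import numFieldNormedType.Exports.

Local Open Scope classical_set_scope.
Local Open Scope ring_scope.

HB.mixin Record NormedModule_isInner (R : realType) V & NormedModule R V := {
  inner : {dot V for (@idfun R)};
  innerxx : forall x : V, inner x x = `|x| ^+ 2
}.

#[short(type="hilbertType")]
HB.structure Definition Hilbert (R : realType) :=
  {V of CompleteNormedModule R V & NormedModule_isInner R V}.

#[short(type="finDimHilbertType")]
HB.structure Definition FinDimHilbert (R : realType) :=
  {V of Hilbert R V & Vector R V}.

Section Definitions.
Context {R : realType} {X : finDimHilbertType R}.
Implicit Types (S A B C K : set X) (x y p : X) (T : X -> X).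

Definition nearest_points C x : set X :=
  [set p | C p /\ forall c, C c -> `|x - p| <= `|x - c|].

(* The nearest point of C to x; it exists and is unique when C is nonempty,
   closed and convex, so that the default value 0 is then irrelevant. *)
Definition projector C x : X := xget 0 (nearest_points C x).

Definition fixed_points T : set X := [set x | T x = x].

Definition rec_cone S : set X := [set x | [set x + s | s in S] `<=` S].

Definition polar_cone S : set X :=
  [set x | (ereal_sup [set (inner x s)%:E | s in S] <= 0)%E].

Definition dual_cone S : set X := [set - x | x in polar_cone S].

Definition set_diff B A : set X := [set b - a | b in B & a in A].

Definition is_cone K : Prop :=
  K = [set t *: x | t in [set t : R | 0 < t] & x in K].

Definition is_ray S : Prop :=
  exists2 d : X, d != 0 & S = [set t *: d | t in [set t : R | 0 <= t]].

Definition is_linear_subspace S : Prop :=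
  exists U : {vspace X}, S = [set x | x \in U].

(* Equal to 0 at x = 0, since 0^-1 = 0. *)
Definition normalize x : X := `|x|^-1 *: x.

Definition quotient_iter T (n : nat) x : X := normalize (iter n T x).

End Definitions.

(* Main.v *)
(* Write d_n = b_n - a_n and e_n = b_n - a_{n+1}, and let u in A, v in B.
   The obtuse-angle inequalities of the two projections give
     |b_{n+1} - v|^2 <= |b_n - v|^2 + |v - u|^2 - |d_{n+1}|^2.
   As |d_n| is nonincreasing, it cannot stay above |v - u|, so d_n and e_n are
   norm-minimizing in B - A and converge to g. Hence T b_n - b_n -> 0; without
   fixed points |T y - y| has a positive minimum on each closed ball, which b_n
   must therefore leave. By convexity the cluster points of b_n / |b_n| are
   recession directions of A and B, and since <b_n, k> is nondecreasing for k in
   K = rec A /\ rec B, they lie in the dual cone of K. A unit vector q in both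
   cones prevents either of them from being a subspace, since <q, -q> < 0. In
   dimension 2 the cone K is a ray, because two independent vectors of K would
   produce a common point of A and B, which T would fix. *)
Require Import Defs.
From HB Require Import structures.
From mathcomp Require Import all_boot all_order all_algebra.
From mathcomp Require Import sesquilinear lra.
From mathcomp Require Import all_classical all_reals all_analysis.

Set Implicit Arguments.
Unset Strict Implicit.
Unset Printing Implicit Defensive.

Import Order.TTheory GRing.Theory Num.Theory.
Import numFieldNormedType.Exports.

Local Open Scope classical_set_scope.
Local Open Scope ring_scope.

(** * Compactness of closed balls in finite dimension *)

Section FiniteDimensional.
Context {R : realType} {X : finDimHilbertType R}.

(** The coordinate map [f] is linear, continuous and bounded below by a multiple of the norm, so the
    ball is the continuous image of a closed bounded set of row vectors. *)
Lemma compact_norm_le (M : R) : compact [set x : X | `|x| <= M].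
Proof.
set n := \dim {: X}; pose b := vbasis {: X}.
pose f (c : 'rV[R]_n) : X := \sum_(i < n) c 0 i *: b`_i.
have fZ t c : f (t *: c) = t *: f c.
  by rewrite scaler_sumr; apply: eq_bigr => i _; rewrite mxE scalerA.
have fc : continuous f.
  apply: (@continuous_big X 'I_n +%R 0 xpredT add_continuous) => i _ c.
  apply: (@continuousZr_tmp _ _ _ (fun c : 'rV[R]_n => c 0 i)).
  exact: coord_continuous.
have f0 c : f c = 0 -> c = 0.
  have /freeP bfree := basis_free (vbasisP {: X}).
  by move=> /(bfree (fun i => c 0 i)) c0; apply/rowP => i; rewrite c0 mxE.
(* [m] is the minimum of [|f c|] on the unit sphere, nonzero because the basis is free; homogeneity
   extends the bound to all [c]. *)
have [m m0 fm] : exists2 m : R, 0 < m & forall c, m * `|c| <= `|f c|.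
  have fNc : continuous (fun c => `|f c|).
    by move=> c; apply: continuous_comp; [exact: fc|exact: norm_continuous].
  (* The sphere is empty only when every [c] is 0, and then any [m] will do. *)
  have [S0|] := pselect ([set c : 'rV[R]_n | `|c| = 1] !=set0); last first.
    move=> S0; exists 1 => // c; rewrite mul1r.
    have [->|c0] := eqVneq c 0; first by rewrite normr0.
    exfalso; apply: S0; exists (`|c|^-1 *: c) => /=.
    by rewrite normrZ normfV normr_id mulVf // normr_eq0.
  have Sc : compact [set c : 'rV[R]_n | `|c| = 1].
    apply: bounded_closed_compact.
      by exists 1; split=> // N N1 c /= ->; exact: ltW.
    apply: (@preimage_closed _ _ (fun c : 'rV[R]_n => `|c|) [set 1]).
      by move=> c _; exact: norm_continuous.
    exact: closed_eq.
  have [c /[!inE]/= c1 cm] :=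
    compact_EVT_min S0 Sc (continuous_subspaceT fNc).
  exists `|f c|.
    by rewrite normr_gt0; apply/eqP => /f0 cE; move: c1; rewrite cE normr0; lra.
  move=> d; have [->|d0] := eqVneq d 0; first by rewrite normr0 mulr0.
  have Nd : 0 < `|d| by rewrite normr_gt0.
  have := cm (`|d|^-1 *: d).
  rewrite inE /= normrZ normfV normr_id mulVf ?gt_eqF// => /(_ erefl).
  by rewrite fZ normrZ normfV normr_id mulrC ler_pdivlMr.
have -> : [set x : X | `|x| <= M] = f @` [set c | `|f c| <= M].
  rewrite eqEsubset; split=> [x xM|_ [c cM <-]//].
  have fx : f (\row_i coord b i x) = x.
    rewrite [RHS](coord_vbasis (memvf x)); apply: eq_bigr => i _.
    by rewrite mxE.
  by exists (\row_i coord b i x); rewrite /= fx.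
apply: continuous_compact; first exact: continuous_subspaceT.
apply: bounded_closed_compact.
  exists (M / m); split=> [|N N1 c /= cM]; first exact: num_real.
  apply/ltW/(le_lt_trans _ N1); rewrite ler_pdivlMr // mulrC.
  exact: le_trans (fm c) cM.
apply: (@preimage_closed _ _ (fun c => `|f c|) [set x | x <= M]).
  by move=> c _; apply: continuous_comp; [exact: fc|exact: norm_continuous].
exact: closed_le.
Qed.

End FiniteDimensional.

(** * Inner product calculus *)

Section InnerProduct.
Context {R : realType} {X : hilbertType R}.
Implicit Types x y z : X.

Lemma innerC x y : inner x y = inner y x.
Proof. by rewrite hermC expr0 mul1r. Qed.

Lemma innerDl x y z : inner (x + y) z = inner x z + inner y z.
Proof. exact: linearDl. Qed.

Lemma innerDr x y z : inner z (x + y) = inner z x + inner z y.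
Proof. exact: linearDr. Qed.

Lemma innerNl x z : inner (- x) z = - inner x z.
Proof. exact: linearNl. Qed.

Lemma innerNr x z : inner z (- x) = - inner z x.
Proof. exact: linearNr. Qed.

Lemma innerZl (t : R) x z : inner (t *: x) z = t * inner x z.
Proof. exact: linearZl_LR. Qed.

Lemma innerZr (t : R) x z : inner z (t *: x) = t * inner z x.
Proof. by rewrite innerC innerZl innerC. Qed.

Definition innerE := (innerDl, innerDr, innerNl, innerNr, innerZl, innerZr).

Lemma innerxx_ge0 x : 0 <= inner x x.
Proof. by rewrite innerxx sqr_ge0. Qed.

Lemma normB_sqr x y : `|x - y| ^+ 2 = `|x| ^+ 2 - 2 * inner x y + `|y| ^+ 2.
Proof. by rewrite -!innerxx !innerE (innerC y x); lra. Qed.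

(** Polarization writes the inner product in terms of norms, which are continuous. *)
Lemma inner_continuous z : continuous (fun x => inner x z : R).
Proof.
have -> : (fun x => inner x z : R) =
    (fun x => (`|x| * `|x| + `|z| ^+ 2 - `|x - z| * `|x - z|) / 2).
  by apply/funext => x; rewrite -!expr2 normB_sqr; lra.
have Nc u : continuous (fun x : X => `|x - u|).
  by move=> x; apply: cvg_norm; apply: cvgB; [exact: cvg_id|exact: cvg_cst].
move=> x; apply: cvgMr_tmp; apply: cvgB; last by apply: cvgM; exact: Nc.
apply: cvgD; [|exact: cvg_cst].
by apply: cvgM; exact: norm_continuous.
Qed.

End InnerProduct.

(** * Convex sets and their closures *)

Section ConvexSets.
Context {R : realType} {X : normedModType R}.
Implicit Types (A C : set X) (x y : X).

Lemma convex_setP C : convex_set C <->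
  forall x y (t : R), C x -> C y -> 0 <= t -> t <= 1 ->
    C (t *: x + (1 - t) *: y).
Proof.
split=> [cC x y t Cx Cy t0 t1|cC x y t].
  by have := cC x y (Itv01 t0 t1); rewrite !inE; apply.
by rewrite !inE => Cx Cy; apply: cC.
Qed.

Lemma closure_normP C x :
  closure C x <-> forall e : R, 0 < e -> exists2 y, C y & `|x - y| < e.
Proof.
split=> [Cx e e0|Cx U /nbhs_ballP[e /= e0 eU]].
  have [y [Cy]] := Cx _ (nbhsx_ballx x e e0).
  by rewrite -ball_normE /=; exists y.
have [y Cy xy] := Cx e e0; exists y; split=> //.
by apply: eU; rewrite -ball_normE.
Qed.

Lemma convex_closure C : convex_set C -> convex_set (closure C).
Proof.
move=> /convex_setP cC; apply/convex_setP => x y t /closure_normP Cx.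
move=> /closure_normP Cy t0 t1; apply/closure_normP => e e0.
have [x' Cx' xx'] := Cx e e0; have [y' Cy' yy'] := Cy e e0.
exists (t *: x' + (1 - t) *: y'); first exact: cC.
rewrite opprD addrACA -!scalerBr (le_lt_trans (ler_normD _ _)) // !normrZ.
rewrite !ger0_norm ?subr_ge0 //.
have [->|t'] := eqVneq t 0; first by rewrite mul0r add0r subr0 mul1r.
have t'' : 0 < t by rewrite lt_neqAle eq_sym t' t0.
have : t * `|x - x'| < t * e by rewrite ltr_pM2l.
have : (1 - t) * `|y - y'| <= (1 - t) * e by rewrite ler_wpM2l ?subr_ge0// ltW.
lra.
Qed.

End ConvexSets.

(** * Nearest points and projectors *)

Section Projector.
Context {R : realType} {X : finDimHilbertType R}.
Implicit Types (A B C : set X) (x y c : X).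

Lemma convex_set_diff A B :
  convex_set A -> convex_set B -> convex_set (set_diff B A).
Proof.
move=> /convex_setP cA /convex_setP cB; apply/convex_setP.
move=> _ _ t [b Bb [a Aa <-]] [b' Bb' [a' Aa' <-]] t0 t1.
exists (t *: b + (1 - t) *: b'); first exact: cB.
exists (t *: a + (1 - t) *: a'); first exact: cA.
by rewrite !scalerBr opprD addrACA.
Qed.

Lemma nearest_points_ex C x : C !=set0 -> closed C -> nearest_points C x !=set0.
Proof.
move=> [c0 Cc0] clC; pose M := `|x| + `|x - c0|.
(* By the triangle inequality a point of norm above [M] is farther from [x] than [c0], so minimizing
   over the compact part of [C] inside this ball suffices. *)
have Mc0 : `|c0| <= M.
  by rewrite /M -[c0 in leLHS](subKr x) (le_trans (ler_normB _ _)).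
have [|||p] := @compact_EVT_min X R (fun c => `|x - c|)
    (C `&` [set c | `|c| <= M]).
- by exists c0.
- by rewrite setIC; apply: compact_closedI => //; exact: compact_norm_le.
- apply: continuous_subspaceT => c; apply: cvg_norm.
  by apply: cvgB; [exact: cvg_cst|exact: cvg_id].
rewrite inE => -[Cp _] pmin; exists p; split=> // c Cc.
have [cM|Mc] := leP `|c| M; first by apply: pmin; rewrite inE.
have /le_trans : `|x - p| <= `|x - c0| by apply: pmin; rewrite inE.
apply; have : `|c| <= `|x| + `|x - c|.
  by rewrite -[c in leLHS](subKr x) (le_trans (ler_normB _ _)).
by move: Mc; rewrite /M; lra.
Qed.

Section OneSet.
Variable C : set X.
Hypotheses (C0 : C !=set0) (clC : closed C) (cvxC : convex_set C).

Lemma projector_nearest x : nearest_points C x (projector C x).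
Proof. by apply: xgetPex; exact: nearest_points_ex. Qed.

Lemma projector_in x : C (projector C x).
Proof. by have [] := projector_nearest x. Qed.

Lemma projector_le x c : C c -> `|x - projector C x| <= `|x - c|.
Proof. by have [_] := projector_nearest x; apply. Qed.

Lemma projector_id x : C x -> projector C x = x.
Proof.
move=> Cx; apply/esym/eqP; rewrite -subr_eq0 -normr_eq0 eq_le normr_ge0.
by have := projector_le x Cx; rewrite subrr normr0 => ->.
Qed.

(** Moving from [p] towards [c] by a fraction [t] cannot reduce the distance to [x]; expanding the
    squares gives [2 t s <= t^2 L], which for small [t] forces [s <= 0]. *)
Lemma projector_obtuse x c :
  C c -> inner (x - projector C x) (c - projector C x) <= 0.
Proof.
move=> Cc; set p := projector C x; set s := inner _ _.
pose L := inner (c - p) (c - p).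
have L0 : 0 <= L := innerxx_ge0 _.
have H t : 0 <= t -> t <= 1 -> 2 * t * s <= t ^+ 2 * L.
  move=> t0 t1.
  have Cq : C (t *: c + (1 - t) *: p).
    by apply: (convex_setP C).1 => //; exact: projector_in.
  have : `|x - p| ^+ 2 <= `|x - (t *: c + (1 - t) *: p)| ^+ 2.
    by rewrite ler_sqr ?nnegrE//; exact: projector_le.
  have -> : x - (t *: c + (1 - t) *: p) = (x - p) - t *: (c - p).
    rewrite scalerBl scale1r scalerBr opprB opprD opprB -[RHS]addrA.
    by congr (_ + _); rewrite addrC -addrA addrCA.
  rewrite [X in _ <= X -> _]normB_sqr -!innerxx !innerZl !innerZr.
  by rewrite -/s -/L; lra.
rewrite leNgt; apply/negP => s0.
(* This [t] satisfies [t L = s - t s < 2 s], against [H] divided by [t]; it is well defined even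
   when [L = 0]. *)
have sL : 0 < s + L by lra.
pose t := s / (s + L).
have t0 : 0 < t by rewrite divr_gt0.
have t1 : t <= 1 by rewrite ler_pdivrMr// mul1r lerDl.
have tE : t * (s + L) = s by rewrite divfK// gt_eqF.
have := H t (ltW t0) t1.
rewrite -mulrA mulrCA expr2 -mulrA ler_pM2l//.
by have := mulr_gt0 t0 s0; lra.
Qed.

(** The two obtuse-angle inequalities add up to [|p - q|^2 <= <x - y, p - q>]; nonnegativity of
    [|(x - y) - (p - q)|^2] then takes the place of Cauchy-Schwarz. *)
Lemma projector_nonexpansive x y :
  `|projector C x - projector C y| <= `|x - y|.
Proof.
rewrite -ler_sqr ?nnegrE//; set p := projector C x; set q := projector C y.
have := projector_obtuse x (projector_in y).
have := projector_obtuse y (projector_in x).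
rewrite -/p -/q -!innerxx.
have := innerxx_ge0 ((x - y) - (p - q)).
rewrite !innerE (innerC y x) (innerC p x) (innerC q x) (innerC p y).
by rewrite (innerC q y) (innerC q p); lra.
Qed.

Lemma projector_continuous : continuous (projector C).
Proof.
move=> x; apply/cvgrPdist_lt => e e0; near=> y.
apply: le_lt_trans (projector_nonexpansive x y) _.
near: y; exact: cvgr_dist_lt.
Unshelve. all: by end_near. Qed.

(** The obtuse-angle inequality at 0 reads [<g, c> >= |g|^2]. It turns near-minimality of the norm
    into closeness to [g]. *)
Lemma projector0_sqr c :
  C c -> `|c - projector C 0| ^+ 2 <= `|c| ^+ 2 - `|projector C 0| ^+ 2.
Proof.
move=> /(projector_obtuse 0); set g := projector C 0.
by rewrite sub0r -!innerxx !innerE (innerC c g); lra.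
Qed.

End OneSet.

Lemma minimizing_cvg (D : set X) (u : nat -> X) :
    D !=set0 -> convex_set D -> (\forall n \near \oo, D (u n)) ->
    (forall v (e : R), D v -> 0 < e ->
      \forall n \near \oo, `|u n| ^+ 2 <= `|v| ^+ 2 + e) ->
  u n @[n --> \oo] --> projector (closure D) 0.
Proof.
move=> [v0 Dv0] cvxD Du umin; set g := projector _ _.
have clD0 : closure D !=set0 by exists v0; exact: subset_closure.
have cvxcl := convex_closure cvxD.
have clg : closure D g := projector_in clD0 (@closed_closure _ _) 0.
apply/cvgrPdist_lt => e e0.
(* One [d] is lost in approximating [g] by a point [v] of [D], another in comparing [u n] with [v];
   the total [2 d] stays below [e^2]. *)
pose d := e ^+ 2 / 4.
have d0 : 0 < d by rewrite divr_gt0// exprn_gt0.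
have [v Dv vg] : exists2 v, D v & `|v| ^+ 2 < `|g| ^+ 2 + d.
  have : {for g, continuous (fun x : X => `|x| * `|x|)}.
    by move=> ?; apply: cvgM; exact: norm_continuous.
  move=> /cvgr_lt/(_ (`|g| ^+ 2 + d)) /=; rewrite -expr2 ltrDl => /(_ d0) /clg.
  by move=> [v [Dv]] /=; rewrite -expr2; exists v.
near=> n.
rewrite distrC -ltr_sqr ?nnegrE// ?(ltW e0)//.
have Dun : D (u n) by near: n.
have := projector0_sqr clD0 (@closed_closure _ _) cvxcl (subset_closure Dun).
have : `|u n| ^+ 2 <= `|v| ^+ 2 + d by near: n; exact: umin.
have : e ^+ 2 = 4 * d by rewrite /d; lra.
rewrite -/g; lra.
Unshelve. all: by end_near. Qed.

End Projector.

(** * Cluster points of sequences *)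

Section ClusterPoints.

Lemma cluster_closed {U : topologicalType} (F : set_system U) (C : set U) q :
  closed C -> F C -> cluster F q -> C q.
Proof. by move=> clC FC Fq; apply: clC => V; exact: Fq. Qed.

Lemma cluster_map {U V : topologicalType} (F : set_system U) (f : U -> V) q :
  {for q, continuous f} -> cluster F q -> cluster (f y @[y --> F]) (f q).
Proof.
move=> fq Fq S W FS Wfq.
by have [y [Sy Wy]] := Fq _ _ FS (fq _ Wfq); exists (f y).
Qed.

Lemma clusterD {R : realType} {V : normedModType R} (u v : nat -> V) q l :
  cluster (u n @[n --> \oo]) q -> v n @[n --> \oo] --> l ->
  cluster (u n + v n @[n --> \oo]) (q + l).
Proof.
move=> uq /cvgrPdist_lt vl S W FS /nbhs_ballP[e /= e0 eW].
have e20 : 0 < e / 2 by rewrite divr_gt0.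
pose good n := S (u n + v n) /\ `|l - v n| < e / 2.
have goodn : \forall n \near \oo, good n.
  by near=> n; split; near: n; [exact: FS|exact: vl].
(* The cluster property yields a value of [u], not an index; restricting to values at good indices
   recovers an [n] at which [v n] is also under control. *)
have Fgood : (u n @[n --> \oo]) [set y | exists2 n, good n & y = u n].
  by apply: filterS goodn => n; exists n.
have [_ [[n [Sn vn] ->]]] := uq _ _ Fgood (nbhsx_ballx q _ e20).
rewrite -ball_normE /= => un; exists (u n + v n); split=> //.
apply: eW; rewrite -ball_normE /= opprD addrACA.
by rewrite (le_lt_trans (ler_normD _ _))//; lra.
Unshelve. all: by end_near. Qed.

Lemma closed_unit_sphere {R : realType} {V : normedModType R} :
  closed [set x : V | `|x| = 1].
Proof.
apply: (@preimage_closed _ _ (fun x : V => `|x|) [set 1]).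
  by move=> x _; exact: norm_continuous.
exact: closed_eq.
Qed.

Lemma unit_cluster_ex {R : realType} {X : finDimHilbertType R}
    (u : nat -> X) :
    (\forall n \near \oo, `|u n| = 1) ->
  exists2 q, cluster (u n @[n --> \oo]) q & `|q| = 1.
Proof.
move=> u1.
have u_le1 : \forall n \near \oo, `|u n| <= 1 by apply: filterS u1 => n ->.
have [q [_ uq]] := @compact_norm_le R X 1 (u n @[n --> \oo]) _ u_le1.
exists q => //.
exact: (cluster_closed (@closed_unit_sphere _ X) u1 uq).
Qed.

Lemma cvg_unique_cluster {R : realType} {X : finDimHilbertType R}
    (u : nat -> X) (q : X) (M : R) :
    (\forall n \near \oo, `|u n| <= M) ->
    (forall p, cluster (u n @[n --> \oo]) p -> p = q) ->
  u n @[n --> \oo] --> q.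
Proof.
move=> uM uq.
have M'M : M <= Num.max M `|q| by rewrite le_max lexx.
have q'M : `|q| <= Num.max M `|q| by rewrite le_max lexx orbT.
(* The extra 1 makes the compact ball of radius [N] a neighbourhood of [q]. *)
pose N := Num.max M `|q| + 1.
have uN : \forall n \near \oo, `|u n| <= N.
  by apply: filterS uM => n un; rewrite /N; lra.
have [p [_ up]] := @compact_norm_le R X N (u n @[n --> \oo]) _ uN.
apply: (@compact_cluster_set1 X q (u n @[n --> \oo]) [set x | `|x| <= N]) => //.
- exact: compact_norm_le.
- have : {for q, continuous (fun x : X => `|x|)} by exact: norm_continuous.
  by move=> /cvgr_le; apply; rewrite /N; lra.
- rewrite eqEsubset; split=> [r /uq ->//|_ ->].
  by rewrite -(uq p up).
Qed.

Lemma invr_cvgy0 {R : realType} (r : nat -> R) :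
  r n @[n --> \oo] --> +oo -> (r n)^-1 @[n --> \oo] --> 0.
Proof.
move=> roo; have r0 : \forall n \near \oo, 0 < r n by exact: cvgry_gt roo 0.
by move/(gtr0_cvgV0 r0): roo.
Qed.

End ClusterPoints.

(** * Recession cones and dual cones *)

Section RecessionCone.
Context {R : realType} {X : finDimHilbertType R}.
Implicit Types (C : set X) (x y d : X).

Lemma rec_coneP C d : rec_cone C d <-> forall c, C c -> C (d + c).
Proof.
split=> [Cd c Cc|Cd _ [c Cc <-]]; last exact: Cd.
by apply: Cd; exists c.
Qed.

Lemma rec_coneD C x y : rec_cone C x -> rec_cone C y -> rec_cone C (x + y).
Proof.
move=> /rec_coneP Cx /rec_coneP Cy; apply/rec_coneP => c Cc.
by rewrite -addrA; apply/Cx/Cy.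
Qed.

(** Integer multiples of [d] are recession directions by iteration; [t *: d + c] lies on the segment
    from [c] to [n.+1%:R *: d + c] once [t <= n.+1]. *)
Lemma rec_coneZ C d (t : R) :
  convex_set C -> rec_cone C d -> 0 <= t -> rec_cone C (t *: d).
Proof.
move=> /convex_setP cvxC Cd t0; apply/rec_coneP => c Cc.
have [n tn] : exists n : nat, t <= n.+1%:R.
  exists (Num.bound t); apply: ltW; rewrite (lt_le_trans (archi_boundP t0))//.
  by rewrite ler_nat.
have Cn : C (n.+1%:R *: d + c).
  suff /rec_coneP : rec_cone C (n.+1%:R *: d) by apply.
  elim: n {tn} => [|n IH]; first by rewrite scale1r.
  by rewrite -addn1 natrD scalerDl scale1r; exact: rec_coneD.
have n0 : (0 : R) < n.+1%:R by rewrite ltr0n.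
have := cvxC _ _ (t / n.+1%:R) Cn Cc.
rewrite divr_ge0// ler_pdivrMr// mul1r tn => /(_ erefl erefl).
rewrite scalerDr scalerA divfK ?gt_eqF// -addrA -scalerDl.
by rewrite subrKC scale1r.
Qed.

Lemma convex_rec_cone C : convex_set C -> convex_set (rec_cone C).
Proof.
move=> cvxC; apply/convex_setP => x y t Cx Cy t0 t1.
by apply: rec_coneD; apply: rec_coneZ => //; rewrite subr_ge0.
Qed.

Lemma closed_rec_cone C : closed C -> closed (rec_cone C).
Proof.
move=> clC d Cd; apply/rec_coneP => c Cc.
have cc : {for d, continuous (fun x => x + c)}.
  by apply: cvgD; [exact: cvg_id|exact: cvg_cst].
apply: clC => W /cc /Cd[x [/rec_coneP Cx Wx]].
by exists (x + c); split=> //; exact: Cx.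
Qed.

(** For [y] in [C], the convex combinations of [c n] and [y] with weights [(r n)^-1] and
    [1 - (r n)^-1] stay in [C] and cluster at [q + y]. *)
Lemma rec_cone_cluster C (c : nat -> X) (r : nat -> R) q :
    closed C -> convex_set C -> (\forall n \near \oo, C (c n)) ->
    r n @[n --> \oo] --> +oo ->
  cluster ((r n)^-1 *: c n @[n --> \oo]) q -> rec_cone C q.
Proof.
move=> clC /convex_setP cvxC Cc roo cq; apply/rec_coneP => y Cy.
have yl : y - (r n)^-1 *: y @[n --> \oo] --> y.
  rewrite -[X in _ --> X]subr0 -[X in _ --> _ - X](scale0r y).
  by apply: cvgB; [exact: cvg_cst|apply: cvgZr_tmp; exact: invr_cvgy0].
suff Cn : \forall n \near \oo, C ((r n)^-1 *: c n + (y - (r n)^-1 *: y)).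
  exact: (cluster_closed clC Cn (clusterD cq yl)).
near=> n; rewrite -[X in X - _]scale1r -scalerBl.
have r1 : 1 <= r n by near: n; exact: cvgry_ge roo 1.
apply: cvxC => //; first by near: n.
  by rewrite invr_ge0; lra.
by rewrite invf_le1//; lra.
Unshelve. all: by end_near. Qed.

Lemma dual_coneP C y : dual_cone C y <-> forall c, C c -> 0 <= inner y c.
Proof.
split=> [[x xC <-] c Cc|yC].
  rewrite innerNl oppr_ge0 -lee_fin; apply: le_trans xC.
  by apply: ereal_sup_ubound; exists c.
exists (- y); last exact: opprK.
apply: ge_ereal_sup => _ [c Cc <-].
by rewrite lee_fin innerNl oppr_le0; exact: yC.
Qed.

Lemma convex_dual_cone C : convex_set (dual_cone C).
Proof.
apply/convex_setP => x y t /dual_coneP xC /dual_coneP yC t0 t1.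
apply/dual_coneP => c Cc; rewrite innerDl !innerZl.
by rewrite addr_ge0// mulr_ge0 ?subr_ge0//; [exact: xC|exact: yC].
Qed.

Lemma dual_coneZ C y (t : R) : dual_cone C y -> 0 <= t -> dual_cone C (t *: y).
Proof.
move=> /dual_coneP yC t0; apply/dual_coneP => c Cc.
by rewrite innerZl mulr_ge0//; exact: yC.
Qed.

(** Two nonnegative multiples of [d] have a nonnegative inner product, so a ray lies in its own dual
    cone. *)
Lemma ray_dual_cone C : is_ray C -> C `&` dual_cone C = C.
Proof.
move=> [d d0 Cd]; apply/seteqP; split=> [y []//|y Cy]; split=> //.
apply/dual_coneP => c; move: Cy; rewrite Cd => -[t /= t0 <-] [s /= s0 <-].
by rewrite innerZl innerZr !mulr_ge0// innerxx_ge0.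
Qed.

Lemma closed_dual_cone C : closed (dual_cone C).
Proof.
have -> : dual_cone C = \bigcap_(c in C) [set y | 0 <= inner y c].
  apply/seteqP; split=> [y /dual_coneP|y yC]; first exact.
  by apply/dual_coneP => c /yC.
apply: closed_bigI => c _.
apply: (@preimage_closed _ _ (fun y => inner y c : R) [set t | 0 <= t]).
  by move=> y _; exact: inner_continuous.
exact: closed_ge.
Qed.

End RecessionCone.

(** * Gaps and steps of alternating projections *)

Section AlternatingProjections.
Context {R : realType} {X : finDimHilbertType R}.
Variables (A B : set X) (a b : nat -> X).
Hypotheses (A0 : A !=set0) (clA : closed A) (cvxA : convex_set A).
Hypotheses (B0 : B !=set0) (clB : closed B) (cvxB : convex_set B).
Hypothesis aS : forall n, a n.+1 = projector A (b n).
Hypothesis bS : forall n, b n.+1 = projector B (a n.+1).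

Let g := projector (closure (set_diff B A)) 0.
Let K := rec_cone A `&` rec_cone B.

(** The recurrences leave [a 0] and [b 0] arbitrary, so membership, and with it every gap estimate,
    starts at index 1. *)
Let Aa n : A (a n.+1).
Proof. by rewrite aS; exact: projector_in. Qed.

Let Bb n : B (b n.+1).
Proof. by rewrite bS; exact: projector_in. Qed.

Lemma gap_decrease n : `|b n.+2 - a n.+2| <= `|b n.+1 - a n.+2|.
Proof.
by rewrite (distrC (b n.+2)) (distrC (b n.+1)) {1}bS; exact: projector_le.
Qed.

Lemma gap_decrease_half n : `|b n.+1 - a n.+2| <= `|b n.+1 - a n.+1|.
Proof. by rewrite aS; exact: projector_le. Qed.

Lemma gap_nonincreasing : nonincreasing_seq (fun n => `|b n.+1 - a n.+1|).
Proof.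
apply/nonincreasing_seqP => n.
exact: le_trans (gap_decrease n) (gap_decrease_half n).
Qed.

(** Projecting onto [B] gives [|r - v|^2 + |r - q|^2 <= |q - v|^2]; projecting onto [A] gives [|q -
    v|^2 <= |p - v|^2 - |p - q|^2 + 2 <p - q, v - u>]. *)
Lemma dist_decrease n u v : A u -> B v ->
  `|b n.+1 - v| ^+ 2 <=
  `|b n - v| ^+ 2 + `|v - u| ^+ 2 - `|b n.+1 - a n.+1| ^+ 2.
Proof.
move=> Au Bv.
have := projector_obtuse A0 clA cvxA (b n) Au.
have := projector_obtuse B0 clB cvxB (a n.+1) Bv.
rewrite -aS -bS; set p := b n; set q := a n.+1; set r := b n.+1.
(* |p - q|^2 - 2 <p - q, v - u> >= - |v - u|^2 *)
have := innerxx_ge0 ((p - q) - (v - u)).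
rewrite -!innerxx !innerE (innerC q p) (innerC r q) (innerC v p) (innerC v q).
by rewrite (innerC v r) (innerC u p) (innerC u q) (innerC u v); lra.
Qed.

Lemma gap_minimizing u v (e : R) : A u -> B v -> 0 < e ->
  \forall n \near \oo, `|b n.+1 - a n.+1| ^+ 2 <= `|v - u| ^+ 2 + e.
Proof.
move=> Au Bv e0.
have [[N gapN]|gap] := pselect
  (exists N, `|b N.+1 - a N.+1| ^+ 2 <= `|v - u| ^+ 2 + e).
  near=> n; apply: le_trans gapN; rewrite ler_sqr ?nnegrE//.
  by apply: gap_nonincreasing; near: n; exact: nbhs_infty_ge.
(* If the squared gap always exceeded [|v - u|^2 + e], each step would lower the squared distance to
   [v] by at least [e], making it negative eventually. *)
have dist_le n : `|b n - v| ^+ 2 <= `|b 0%N - v| ^+ 2 - n%:R * e.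
  elim: n => [|n IH]; first by rewrite mul0r subr0.
  have := dist_decrease n Au Bv.
  have : ~ (`|b n.+1 - a n.+1| ^+ 2 <= `|v - u| ^+ 2 + e).
    by move=> gapn; apply: gap; exists n.
  by move/negP; rewrite -ltNge -natr1 mulrDl mul1r; lra.
have D0 : 0 <= `|b 0%N - v| ^+ 2 / e by rewrite divr_ge0 ?sqr_ge0// ltW.
have := archi_boundP D0; rewrite ltr_pdivrMr// => lt_bound.
have := dist_le (Num.bound (`|b 0%N - v| ^+ 2 / e)).
by have := sqr_ge0 `|b (Num.bound (`|b 0%N - v| ^+ 2 / e)) - v|; lra.
Unshelve. all: by end_near. Qed.

Let diff0 : set_diff B A !=set0.
Proof. by exists (b 1%N - a 1%N); exists (b 1%N) => //; exists (a 1%N). Qed.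

Let cvxD : convex_set (set_diff B A).
Proof. exact: convex_set_diff. Qed.

Lemma gap_cvg : b n - a n @[n --> \oo] --> g.
Proof.
rewrite -(cvg_shiftS (fun n => b n - a n)); apply: minimizing_cvg => //.
  by near=> n; exists (b n.+1) => //; exists (a n.+1).
by move=> _ e [v Bv [u Au <-]] e0; exact: gap_minimizing.
Unshelve. all: by end_near. Qed.

(** Each half gap, from index 1 on, lies in [set_diff B A] and is no longer than the preceding gap,
    so it inherits the minimizing property. *)
Lemma half_gap_cvg : b n - a n.+1 @[n --> \oo] --> g.
Proof.
rewrite -(cvg_shiftS (fun n => b n - a n.+1)); apply: minimizing_cvg => //.
  by near=> n; exists (b n.+1) => //; exists (a n.+2).
move=> _ e [v Bv [u Au <-]] e0.
apply: filterS (gap_minimizing Au Bv e0) => n; apply: le_trans.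
by rewrite ler_sqr ?nnegrE//; exact: gap_decrease_half.
Unshelve. all: by end_near. Qed.

(** A step is a gap minus a half gap, and both tend to [g]. *)
Lemma step_cvg0 : b n.+1 - b n @[n --> \oo] --> (0 : X).
Proof.
have -> : (fun n => b n.+1 - b n) =
    (fun n => (b n.+1 - a n.+1) - (b n - a n.+1)).
  by apply/funext => n; rewrite opprB addrA subrK.
rewrite -(subrr g); apply: cvgB; last exact: half_gap_cvg.
by have := gap_cvg; rewrite -(cvg_shiftS (fun n => b n - a n)).
Qed.

(** Testing the obtuse-angle inequalities at [a n.+1 + k] and [b n.+1 + k] gives
    [<b n, k> <= <a n.+1, k> <= <b n.+1, k>]. *)
Lemma inner_step k n : K k -> inner (b 0%N) k <= inner (b n) k.
Proof.
move=> [/rec_coneP Ak /rec_coneP Bk]; elim: n => [//|n /le_trans]; apply.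
have := projector_obtuse A0 clA cvxA (b n) (Ak _ (Aa n)).
have := projector_obtuse B0 clB cvxB (a n.+1) (Bk _ (Bb n)).
by rewrite -aS -bS !addrK !innerE; lra.
Qed.

(** * Divergence and asymptotic directions without fixed points *)

Section NoFixedPoint.
Hypothesis nofix : forall y, projector B (projector A y) <> y.

Lemma norm_b_cvgy : `|b n| @[n --> \oo] --> +oo.
Proof.
apply/cvgryPge => M; set T := projector B \o projector A.
have Tc : continuous (fun y => `|T y - y|).
  move=> y; apply: cvg_norm; apply: cvgB; last exact: cvg_id.
  by apply: continuous_comp; exact: projector_continuous.
(* For an empty ball, that is for negative [M], the bound is immediate; otherwise the displacement
   [|T y - y|] attains a minimum there. *)
have [M0|M0] := pselect ([set y : X | `|y| <= M] !=set0); last first.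
  apply: nearW => n; rewrite leNgt; apply/negP => /ltW bM.
  by apply: M0; exists (b n).
have [p _ pmin] :=
  compact_EVT_min M0 (@compact_norm_le R X M) (continuous_subspaceT Tc).
have m0 : 0 < `|T p - p|.
  by rewrite normr_gt0 subr_eq0; apply/eqP/nofix.
have near_step : \forall n \near \oo, `|b n.+1 - b n| < `|T p - p|.
  exact: cvgr0_norm_lt step_cvg0 _ m0.
apply: filterS near_step => n.
rewrite bS aS => lt_m; rewrite leNgt; apply/negP => /ltW bM.
have : `|T p - p| <= `|T (b n) - b n| by apply: pmin; rewrite inE.
by rewrite leNgt lt_m.
Qed.

Lemma norm_a_cvgy : `|a n| @[n --> \oo] --> +oo.
Proof.
apply/cvgryPge => M.
have g1 : `|g| < `|g| + 1 by rewrite ltrDl.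
near=> n.
have : `|b n - a n| < `|g| + 1.
  by near: n; exact: cvgr_lt (cvg_norm gap_cvg) _ g1.
have : M + (`|g| + 1) <= `|b n| by near: n; exact: cvgry_ge norm_b_cvgy _.
have : `|b n| <= `|b n - a n| + `|a n|.
  by rewrite -[X in `|X| <= _](subrK (a n)) ler_normD.
lra.
Unshelve. all: by end_near. Qed.

(** This holds only eventually, since [normalize] sends 0 to 0. *)
Lemma normalize_b_norm : \forall n \near \oo, `|normalize (b n)| = 1.
Proof.
near=> n.
have b0 : 0 < `|b n| by near: n; exact: cvgry_gt norm_b_cvgy 0.
by rewrite normrZ normfV normr_id mulVf// gt_eqF.
Unshelve. all: by end_near. Qed.

(** For [A], the points [a n] are scaled by the norms of [b n]: the result differs from
    [normalize (b n)] by a bounded gap divided by a norm tending to infinity. *)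
Lemma cluster_rec_cone q :
  cluster (normalize (b n) @[n --> \oo]) q -> K q.
Proof.
move=> bq; split; last first.
  apply: rec_cone_cluster norm_b_cvgy bq => //.
  by exists 1%N => // -[].
have Aan : \forall n \near \oo, A (a n) by exists 1%N => // -[].
apply: (rec_cone_cluster clA cvxA Aan norm_b_cvgy).
have v0 : - (`|b n|^-1 *: (b n - a n)) @[n --> \oo] --> (0 : X).
  rewrite -[X in _ --> X]oppr0 -[X in _ --> - X](scale0r g).
  by apply: cvgN; apply: cvgZ; [exact: invr_cvgy0 norm_b_cvgy|exact: gap_cvg].
have -> : (fun n => `|b n|^-1 *: a n) =
    (fun n => normalize (b n) + - (`|b n|^-1 *: (b n - a n))).
  by apply/funext => n; rewrite /normalize scalerBr opprB addrC subrK.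
by rewrite -[q]addr0; exact: clusterD.
Qed.

(** Divided by [|b n|], the constant lower bound of [inner_step] tends to 0, leaving [<q, k> >= 0]
    in the limit. *)
Lemma cluster_dual_cone q :
  cluster (normalize (b n) @[n --> \oo]) q -> dual_cone K q.
Proof.
move=> bq; apply/dual_coneP => k Kk.
have iq : cluster ((inner (normalize (b n)) k : R) @[n --> \oo]) (inner q k).
  exact: (cluster_map (@inner_continuous R X k q) bq).
have v0 : - (`|b n|^-1 * inner (b 0%N) k) @[n --> \oo] --> (0 : R).
  rewrite -[X in _ --> X]oppr0 -[X in _ --> - X](mul0r (inner (b 0%N) k)).
  by apply: cvgN; apply: cvgMr_tmp; exact: invr_cvgy0 norm_b_cvgy.
rewrite -[inner q k]addr0.
suff ge0 : \forall n \near \oo,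
    0 <= inner (normalize (b n)) k + - (`|b n|^-1 * inner (b 0%N) k).
  exact: (cluster_closed (@closed_ge R 0) ge0 (clusterD (V := R^o) iq v0)).
apply: nearW => n; rewrite /normalize innerZl -mulrBr.
by rewrite mulr_ge0 ?invr_ge0// subr_ge0; exact: inner_step.
Qed.

Lemma normalize_b_cluster_ex :
  exists2 q, cluster (normalize (b n) @[n --> \oo]) q & `|q| = 1.
Proof. exact: unit_cluster_ex normalize_b_norm. Qed.

Lemma cluster_norm q :
  cluster (normalize (b n) @[n --> \oo]) q -> `|q| = 1.
Proof. exact: cluster_closed (@closed_unit_sphere _ X) normalize_b_norm. Qed.

(** A ray contains exactly one unit vector, so the bounded sequence has a single cluster point. *)
Lemma normalize_b_cvg :
  is_ray (K `&` dual_cone K) -> cvg (normalize (b n) @[n --> \oo]).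
Proof.
move=> [d d0 Kd]; apply/cvg_ex; exists (`|d|^-1 *: d).
apply: (@cvg_unique_cluster _ _ _ _ 1).
  by apply: filterS normalize_b_norm => n ->.
move=> p bp.
have : (K `&` dual_cone K) p.
  by split; [exact: cluster_rec_cone|exact: cluster_dual_cone].
rewrite Kd => -[t /= t0 pE].
have := cluster_norm bp; rewrite -pE normrZ ger0_norm// => td.
by congr (_ *: _); rewrite -[LHS](mulfK (_ : `|d| != 0)) ?td ?mul1r ?normr_eq0.
Qed.

Lemma no_common_point y : A y -> ~ B y.
Proof. by move=> Ay By; apply: (nofix (y := y)); rewrite !projector_id. Qed.

Lemma rec_coneID y z : K y -> K z -> K (y + z).
Proof. by move=> [Ay By] [Az Bz]; split; exact: rec_coneD. Qed.

Lemma rec_coneIZ y (t : R) : K y -> 0 <= t -> K (t *: y).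
Proof. by move=> [Ay By] t0; split; exact: rec_coneZ. Qed.

(* If k and q spanned X, splitting the coefficients of a - b into positive and
   negative parts would give a + k1 = b + k2 with k1, k2 in K, a common point
   of A and B. *)
Lemma dim2_ray : \dim {: X} = 2%N -> is_ray K.
Proof.
move=> dim2; have [q bq q1] := normalize_b_cluster_ex.
have Kq := cluster_rec_cone bq.
have /dual_coneP Kdq := cluster_dual_cone bq.
have q0 : q != 0 by rewrite -normr_gt0 q1.
exists q => //; apply/seteqP; split=> [k Kk|_ [t t0 <-]]; last exact: rec_coneIZ.
have [/vlineP[t kE]|kq] := boolP (k \in <[q]>%VS).
  (* Since [|q| = 1], the coefficient [t] equals [<q, k>], which is nonnegative because [q] is in
     the dual cone. *)
  exists t => //=.
  by have := Kdq _ Kk; rewrite kE innerZr innerxx q1 expr1n mulr1.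
exfalso.
have spanE : (<[k]> + <[q]> = {: X})%VS.
  apply/eqP; rewrite eqEdim subvf /= dim2.
  have : free [:: k; q] by rewrite free_cons span_seq1 kq seq1_free.
  by rewrite /free span_cons span_seq1 => /eqP ->.
have : a 1%N - b 1%N \in (<[k]> + <[q]>)%VS by rewrite spanE memvf.
move=> /memv_addP[_ /vlineP[s ->] [_ /vlineP[t ->] abE]].
pose pos (r : R) := Num.max r 0.
have pos_ge0 r : 0 <= pos r by rewrite le_max lexx orbT.
have posE r : pos r - pos (- r) = r.
  by rewrite /pos; case: (leP r 0); case: (leP (- r) 0); lra.
have [/rec_coneP A' _] :=
  rec_coneID (rec_coneIZ Kk (pos_ge0 (- s))) (rec_coneIZ Kq (pos_ge0 (- t))).
have [_ /rec_coneP B'] :=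
  rec_coneID (rec_coneIZ Kk (pos_ge0 s)) (rec_coneIZ Kq (pos_ge0 t)).
apply: (no_common_point (A' _ (Aa 0%N))).
have -> : a 1%N = s *: k + t *: q + b 1%N by rewrite -abE subrK.
suff -> : pos (- s) *: k + pos (- t) *: q + (s *: k + t *: q + b 1%N) =
   pos s *: k + pos t *: q + b 1%N by exact: B'.
rewrite addrA addrACA -!scalerDl -{2}(posE s) -{2}(posE t).
by rewrite ![pos (- _) + _]addrC !subrK.
Qed.

End NoFixedPoint.
End AlternatingProjections.

Theorem theorem2p5 (R : realType) (X : finDimHilbertType R) (A B : set X)
    (A0 : A !=set0) (clA : closed A) (cvxA : convex_set A)
    (B0 : B !=set0) (clB : closed B) (cvxB : convex_set B)
    (T : X -> X) (TE : T = projector B \o projector A) (FixT : fixed_points T = set0)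
    (x : X) (a b : nat -> X) (b0 : b 0%N = x)
    (aS : forall n : nat, a n.+1 = projector A (b n))
    (bS : forall n : nat, b n.+1 = projector B (a n.+1)) :
  let g := projector (closure (set_diff B A)) 0 in
  let K := rec_cone A `&` rec_cone B in
  ([/\ `|a n| @[n --> \oo] --> +oo,
      `|b n| @[n --> \oo] --> +oo,
      b n - a n @[n --> \oo] --> g &
      a n.+1 - b n @[n --> \oo] --> - g]) /\
  ([/\ cluster (normalize (b n) @[n --> \oo]) `<=` K `&` dual_cone K,
      closed (K `&` dual_cone K),
      convex_set (K `&` dual_cone K),
      is_cone (K `&` dual_cone K) &
      [set 0] `<` K `&` dual_cone K]) /\
  (~ is_linear_subspace K /\ ~ is_linear_subspace (dual_cone K)) /\
  ((forall n : nat, quotient_iter T n x = normalize (b n)) /\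
   ([\/ is_ray (K `&` dual_cone K), is_ray K | \dim {: X} = 2%N] ->
    cvg (quotient_iter T n x @[n --> \oo]))).
Proof.
move=> g K.
have nofix y : projector B (projector A y) <> y.
  move=> yE; suff : fixed_points T y by rewrite FixT.
  by rewrite /fixed_points /= TE.
have iterE n : quotient_iter T n x = normalize (b n).
  congr normalize; elim: n => [//|n IH].
  by rewrite iterS IH bS aS TE.
have K2Z y (t : R) : (K `&` dual_cone K) y -> 0 <= t ->
    (K `&` dual_cone K) (t *: y).
  move=> [[Ay By] Ky] t0; split; first by split; exact: rec_coneZ.
  exact: dual_coneZ.
have [q bq q1] := normalize_b_cluster_ex A0 clA cvxA B0 clB cvxB aS bS nofix.
have clusterK p : cluster (normalize (b n) @[n --> \oo]) p ->
    (K `&` dual_cone K) p.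
  move=> bp; split;
    first exact: (cluster_rec_cone A0 clA cvxA B0 clB cvxB aS bS).
  exact: (cluster_dual_cone A0 clA cvxA B0 clB cvxB aS bS).
have [Kq Kdq] := clusterK q bq.
have inner_qNq : ~ 0 <= inner q (- q).
  by rewrite innerNr innerxx q1 expr1n oppr_ge0 ler10.
split; last split; last split; last split.
- split.
  + exact: (norm_a_cvgy A0 clA cvxA B0 clB cvxB).
  + exact: (norm_b_cvgy A0 clA cvxA B0 clB cvxB).
  + exact: gap_cvg.
  + have -> : (fun n => a n.+1 - b n) = (fun n => - (b n - a n.+1)).
      by apply/funext => n; rewrite opprB.
    by apply: cvgN; exact: half_gap_cvg.
- split=> //.
  + apply: closedI; last exact: closed_dual_cone.
    by apply: closedI; exact: closed_rec_cone.
  + apply/convex_setP => y z t [[Ay By] Ky] [[Az Bz] Kz] t0 t1.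
    split; first split.
    * exact: (convex_setP _).1 (convex_rec_cone cvxA) _ _ _ Ay Az t0 t1.
    * exact: (convex_setP _).1 (convex_rec_cone cvxB) _ _ _ By Bz t0 t1.
    * exact: (convex_setP _).1 (@convex_dual_cone _ _ K) _ _ _ Ky Kz t0 t1.
  + apply/seteqP; split=> [y Ky|_ [t /= t0 [y Ky <-]]].
      by exists 1 => /=; [exact: ltr01|exists y => //; rewrite scale1r].
    by apply: K2Z => //; exact: ltW.
  (* The unit cluster point [q] shows that the inclusion is proper. *)
  + split=> [_ ->|K0]; first by rewrite -(scale0r q); exact: K2Z.
    have q0 : q = 0 by apply: K0.
    by move: q1; rewrite q0 normr0 => /esym/eqP; rewrite oner_eq0.
- split=> -[U UE].
    apply: inner_qNq; apply: (dual_coneP _ _).1 Kdq _ _.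
    by move: Kq; rewrite UE /= memvN.
  apply: inner_qNq; rewrite innerC; move: Kdq; rewrite UE /= -memvN => Uq.
  by apply: (dual_coneP K (- q)).1 => //; rewrite UE.
- exact: iterE.
- move=> H; rewrite (eq_fun iterE).
  (* Case (b) reduces to case (a) by this implication, and case (c) to case (b) by [dim2_ray]. *)
  have rayP : is_ray K -> is_ray (K `&` dual_cone K).
    by move=> rK; rewrite ray_dual_cone.
  apply: (normalize_b_cvg A0 clA cvxA B0 clB cvxB aS bS nofix).
  case: H => [//|/rayP//|dim2]; apply: rayP.
  exact: dim2_ray dim2.
Qed.
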